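(* There exists an algorithm which, given as input a connected cactus graph $G$ with $n$ vertices, computes $Z_0(G)$ in time $O(n^2)$.
   Context: Graphs are finite, simple and undirected. A cactus graph is a graph in which each edge belongs to at most one cycle (equivalently, any two cycles share at most one vertex). The $q$-analogue of zero forcing ($Z_q$ game), for a fixed integer $q\ge 0$, is a game between a player and an oracle on a graph $G$. Initially all vertices are unfilled. The player repeatedly uses the following rules. Rule 1: fill any vertex at the cost of one token. Rule 2 (forcing rule): at no cost, a filled vertex with a unique unfilled neighbor forces that neighbor to be filled. Rule 3: let $F$ be the set of filled vertices and let $U_1,\dots,U_k$ be the connected components of $G[V\setminus F]$; if $k>q$, the player selects at least $q+1$ of the components $U_i$; the oracle then chooses a nonempty subset $\{U_{i_1},\dots,U_{i_l}\}$ of the selected components; the player may then, at no cost, apply the forcing rule in the subgraph of $G$ induced by $F\cup U_{i_1}\cup\dots\cup U_{i_l}$. The number $Z_q(G)$ is the minimum number of tokens with which the player can guarantee to fill all vertices of $G$, against an oracle trying to maximize the number of tokens spent. In particular $Z_0$ is the case $q=0$. *)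

(* Defs.v *)
From mathcomp Require Import all_boot.
From mathcomp Require Import boolp.

Set Implicit Arguments.
Unset Strict Implicit.
Unset Printing Implicit Defensive.

(** * Graphs, given by their adjacency relation on a finite vertex type *)

Section Graphs.
Variable T : finType.
Implicit Types (e : rel T) (c : seq T) (W : {set T}).

Definition simple_graph e := symmetric e /\ irreflexive e.

(* The null graph is not counted as connected. *)
Definition connected_graph e := 0 < #|T| /\ forall x y : T, connect e x y.

Definition is_cycle e c := ucycle e c /\ 2 < size c.

(* A vertex sequence presents a cycle only up to rotation and reversal; the
   cycle, as a subgraph, is determined by its set of edges. *)
Definition cycle_edges c : {set {set T}} := [set [set x; next c x] | x in c].

Definition cactus e :=
  forall c1 c2, is_cycle e c1 -> is_cycle e c2 ->
  forall f : {set T}, f \in cycle_edges c1 -> f \in cycle_edges c2 ->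
  cycle_edges c1 = cycle_edges c2.

Definition induced e W : rel T := [rel x y | [&& x \in W, y \in W & e x y]].

Definition components e W : {set {set T}} :=
  equivalence_partition (connect (induced e W)) W.

(** * The Z_q game *)

(* One application of the forcing rule in the subgraph induced by [W], taking
   the filled set from [F] to [F']. *)
Definition force_step e W : rel {set T} := [rel F F' : {set T} |
  [exists u in F :&: W, exists w in W :\: F,
    [&& e u w, [forall x in W :\: F, e u x ==> (x == w)] & F' == w |: F]]].

(* [player_wins q e k F]: when the filled set is [F], the player has a strategy
   that fills every vertex with at most [k] further tokens, whatever the oracle
   does.  In rule 3 the player selects the set [S] of components (so that there
   are more than [q] of them), the oracle answers with a nonempty [A] included
   in [S], and [reply A] is the filled set that the player reaches by any
   number of forces, possibly none, in the subgraph induced by [F] and the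
   components in [A]. *)
Inductive player_wins (q : nat) e : nat -> {set T} -> Prop :=
| wins_full k : player_wins q e k [set: T]
| wins_token k F v : player_wins q e k (v |: F) -> player_wins q e k.+1 F
| wins_force k F F' :
    force_step e [set: T] F F' -> player_wins q e k F' -> player_wins q e k F
| wins_oracle k F (S : {set {set T}}) (reply : {set {set T}} -> {set T}) :
    S \subset components e (~: F) -> q < #|S| ->
    (forall A : {set {set T}}, A \subset S -> A != set0 ->
       connect (force_step e (F :|: cover A)) F (reply A)) ->
    (forall A : {set {set T}}, A \subset S -> A != set0 ->
       player_wins q e k (reply A)) ->
    player_wins q e k F.

Lemma player_wins_all_tokens q e : exists k, `[< player_wins q e k set0 >].
Proof.
suff H m (F : {set T}) : #|~: F| = m -> player_wins q e m F.
  by exists #|~: (set0 : {set T})|; apply/asboolP/H.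
elim: m F => [|m IHm] F.
  move/eqP; rewrite cards_eq0 => /eqP F0.
  by rewrite -(setCK F) F0 setC0; apply: wins_full.
move=> cF; have /card_gt0P[v vF] : 0 < #|~: F| by rewrite cF.
apply: (@wins_token _ _ _ _ v); apply: IHm.
move: cF; rewrite (cardsD1 v) vF add1n => -[<-]; congr #|pred_of_set _|.
by apply/setP => x; rewrite !inE negb_or.
Qed.

Definition Zq q e : nat := ex_minn (player_wins_all_tokens q e).

End Graphs.

(** * Random access machines *)

(* A unit-cost RAM whose registers and memory cells hold natural numbers below
   a bound [w] (2 ^ b for b-bit words).  Its only arithmetic operations
   are addition and truncated subtraction. *)
Inductive instr :=
| Const of nat & nat        (* Const r k : R[r] := k *)
| Add of nat & nat & nat    (* Add r a b : R[r] := R[a] + R[b] *)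
| Sub of nat & nat & nat    (* Sub r a b : R[r] := R[a] - R[b] *)
| Read of nat & nat         (* Read r a  : R[r] := M[R[a]] *)
| Write of nat & nat        (* Write a b : M[R[a]] := R[b] *)
| Jump of nat               (* Jump l    : goto l *)
| JumpLt of nat & nat & nat (* JumpLt a b l : if R[a] < R[b] goto l *)
| Halt.

Definition program := seq instr.

Record state := State { pc : nat; regs : nat -> nat; mem : nat -> nat }.

(* Writing a value that does not fit in a word aborts the computation. *)
Definition set_reg w s r v : option state :=
  if v < w then Some (State (pc s).+1 [eta regs s with r |-> v] (mem s))
  else None.

(* One step; [None] means that the machine has halted or aborted. *)
Definition step w s (i : instr) : option state :=
  let R := regs s in
  match i with
  | Const r k => set_reg w s r k
  | Add r a b => set_reg w s r (R a + R b)
  | Sub r a b => set_reg w s r (R a - R b)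
  | Read r a => set_reg w s r (mem s (R a))
  | Write a b => Some (State (pc s).+1 R [eta mem s with R a |-> R b])
  | Jump l => Some (State l R (mem s))
  | JumpLt a b l => Some (State (if R a < R b then l else (pc s).+1) R (mem s))
  | Halt => None
  end.

(* [run p w t s = Some z]: started in [s], the program [p] reaches [Halt] (or
   the end of the program) after at most [t] steps, without aborting, and then
   R[0] = z. *)
Fixpoint run (p : program) w t s : option nat :=
  match nth Halt p (pc s), t with
  | Halt, _ => Some (regs s 0)
  | _, 0 => None
  | i, t'.+1 => obind (run p w t') (step w s i)
  end.

(* A graph on the vertices 0, ..., n-1 is input as its adjacency matrix, stored
   row by row from cell 0 on, with n in R[0] and zeros everywhere else. *)
Definition graph_input n (e : rel 'I_n) : state :=
  State 0 [eta (fun=> 0) with 0 |-> n]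
    (fun a => [exists i : 'I_n, exists j : 'I_n, (a == i * n + j) && e i j]).

(* Main.v *)
Require Import Defs.
From mathcomp Require Import all_boot.
From mathcomp Require Import boolp zify.

Set Implicit Arguments.
Unset Strict Implicit.
Unset Printing Implicit Defensive.

(** The theorem holds because the answer has a closed form: a connected cactus
    with n vertices and m edges has Z_0 = m - n + 2, and counting the entries
    below the diagonal of the adjacency matrix takes O(n^2) steps on words of
    O(log n) bits.  As q = 0, the player may select a single component in
    rule 3, which leaves the oracle no choice: Z_0 is the positive semidefinite
    zero forcing number.

    Upper bound [Zq0_upper], for every connected graph.  Order the vertices so
    that each one but the first, r, has an earlier neighbour, and put a token on
    each vertex whose number of earlier neighbours is not 1.  A vertex other
    than r with k earlier neighbours then costs at most k - 1 tokens, so that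
    at most 1 + (m - (n - 1)) tokens are spent.  The remaining vertices have a
    single earlier neighbour, and the first vertex of any unfilled component
    can be forced by its own ([wins_from_token_set]).

    Lower bound [Zq0_lower].  Given c pairwise edge-disjoint cycles, at most
    k - 2 edges of a cycle of length k ever carry a force, because a force along
    the cycle is impossible as long as only one vertex of the cycle is filled
    ([cycle_force_late]).  A force uses up one edge, so at most m - 2c vertices
    are forced and at least n - m + 2c tokens are spent.  A potential of the
    filled set does this bookkeeping along a play ([potential_force],
    [player_wins_potential]).

    In a cactus the fundamental cycles of a spanning tree are edge-disjoint, as
    the chord of one lies on no other; there are at least c = m - n + 1 of them,
    for which n - m + 2c is m - n + 2 ([Zq0_cactus]). *)

(** * Orderings of a connected graph *)

(** Ordering by the distance to r; the rank of x in the enumeration of T only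
    breaks ties. *)
Lemma earlier_neighbour_rank (T : finType) (e : rel T) :
  symmetric e -> connected_graph e ->
  exists (r : T) (rank : T -> nat), injective rank /\
    forall x, x != r -> exists y, e x y && (rank y < rank x).
Proof.
move=> sym [/card_gt0P[r _] conn]; exists r.
have walk x : exists k, `[< exists p, [/\ path e r p, last r p = x & size p = k] >].
  have /connectP[p ep ->] := conn r x.
  by exists (size p); apply/asboolP; exists p.
pose dist x := ex_minn (walk x).
exists (fun x => dist x * #|T| + enum_rank x); split=> [x y eq_xy | x xr].
  apply/enum_rank_inj/val_inj; move: (congr1 (modn^~ #|T|) eq_xy).
  by rewrite /= !modnMDl !modn_small.
have: exists2 y, e x y & dist y < dist x.
  have [p [ep lp sp]] : exists p, [/\ path e r p, last r p = x & size p = dist x].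
    by rewrite /dist; case: ex_minnP => k /asboolP.
  move: ep lp sp; case/lastP: p => [_ rx|p y].
    by rewrite -rx eqxx in xr.
  rewrite rcons_path last_rcons size_rcons => /andP[ep ey] <- <-.
  exists (last r p); first by rewrite sym.
  by rewrite ltnS /dist; case: ex_minnP => l _; apply; apply/asboolP; exists p.
case=> y exy lt_yx; exists y; rewrite exy /=.
have le : (dist y).+1 * #|T| <= dist x * #|T| by rewrite leq_mul2r lt_yx orbT.
apply: leq_trans (leq_addr _ _); apply: leq_trans le.
by rewrite mulSn addnC ltn_add2r.
Qed.

(** * Upper bound: a token set for every connected graph *)

Section UpperBound.
Variables (T : finType) (e : rel T).
Hypothesis sym : symmetric e.

(** With q = 0 the player can select the component of w alone, and the only
    nonempty subset that the oracle can answer is this component. *)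
Lemma wins_component_force k (F : {set T}) u w :
  u \in F -> w \notin F -> e u w ->
  (forall x, connect (induced e (~: F)) w x -> x \notin F -> e u x -> x = w) ->
  player_wins 0 e k (w |: F) -> player_wins 0 e k F.
Proof.
move=> uF wF euw only win.
pose U := [set x in ~: F | connect (induced e (~: F)) w x].
have wU : w \in U by rewrite !inE wF connect0.
apply: (@wins_oracle _ _ _ _ _ [set U] (fun=> w |: F)) => //.
- by rewrite sub1set; apply/imsetP; exists w; rewrite ?inE.
- by rewrite cards1.
move=> A; rewrite subset1 => /orP[/eqP-> _|/eqP->]; [|by rewrite eqxx].
apply: connect1; rewrite /cover big_set1 /=.
apply/exists_inP; exists u; first by rewrite !inE uF.
apply/exists_inP; exists w; first by rewrite !inE wF connect0 orbT.
rewrite euw eqxx andbT; apply/forall_inP => x; rewrite !inE.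
move=> /andP[xF]; rewrite (negPf xF) /= => conn_wx.
by apply/implyP => eux; apply/eqP/only.
Qed.

Lemma wins_tokens k (F S : {set T}) :
  player_wins 0 e k (S :|: F) -> player_wins 0 e (#|S| + k) F.
Proof.
move: {2}#|S| (erefl #|S|) => n cS; rewrite cS.
elim: n S cS F => [|n IH] S cS F win.
  by move/eqP: cS win; rewrite cards_eq0 => /eqP->; rewrite set0U.
have /card_gt0P[v vS] : 0 < #|S| by rewrite cS.
apply: (@wins_token _ _ _ _ _ v).
move: cS; rewrite (cardsD1 v) vS => -[cS].
by apply: (IH (S :\ v)) => //; rewrite setUCA setUA setD1K.
Qed.

Variables (r : T) (rank : T -> nat).
Hypothesis rank_inj : injective rank.
Hypothesis has_earlier : forall x, x != r -> exists y, e x y && (rank y < rank x).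

Definition earlier x := [set y | e x y & rank y < rank x].

(** The root has no earlier neighbour, so that it belongs to this set as well. *)
Definition token_set := [set x | #|earlier x| != 1].

(** Let w be the unfilled vertex of least rank and p its earlier neighbour, which
    is filled.  As unfilled vertices have a single earlier neighbour, the
    component of w is the tree of the descendants of w.  An unfilled neighbour x
    of p in it has p as its earlier neighbour; if x were not w, that neighbour
    would be unfilled, being a descendant of w.  So p forces w. *)
Lemma wins_from_token_set (F : {set T}) :
  token_set \subset F -> player_wins 0 e 0 F.
Proof.
move: {2}#|~: F| (erefl #|~: F|) => n; elim: n F => [|n IH] F cF tokF.
  move/eqP: cF; rewrite cards_eq0 => /eqP F0.
  by rewrite -(setCK F) F0 setC0; apply: wins_full.
have /card_gt0P[z zF] : 0 < #|~: F| by rewrite cF.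
have [w] := @arg_minnP _ z (mem (~: F)) rank zF.
rewrite inE in_setC => wF w_min.
have early1 x : x \notin F -> exists y, earlier x = [set y].
  move=> xF; apply/cards1P; apply: contraNT xF => h.
  by apply: (subsetP tokF); rewrite inE.
have earlyE x y a : earlier x = [set a] -> e x y -> rank y < rank x -> y = a.
  by move=> ex exy lt; apply/set1P; rewrite -ex inE exy.
have [p earlier_w] := early1 w wF.
have /andP[ewp lt_pw] : e w p && (rank p < rank w).
  by have := set11 p; rewrite -earlier_w inE.
have pF : p \in F.
  by apply: contraLR lt_pw => pF; rewrite -leqNgt w_min ?inE.
apply: (@wins_component_force _ _ p w) => //; first by rewrite sym.
  pose desc := connect [rel a b | [&& a \notin F, b \notin F & earlier b == [set a]]] w.
  have desc_white y : desc y -> y \notin F.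
    case/connectP=> s; case/lastP: s => [_ -> //|s b].
    by rewrite rcons_path last_rcons => /andP[_ /and3P[]] _ bF _ ->.
  have desc_parent y : desc y -> y = w \/ exists2 a, desc a & earlier y = [set a].
    case/connectP=> s; case/lastP: s => [_ ->|s b]; first by left.
    rewrite rcons_path last_rcons => /andP[ps /and3P[_ _ /eqP eb]] ->; right.
    by exists (last w s) => //; apply/connectP; exists s.
  move=> x conn_wx xF epx.
  have: desc x.
    have walk s a : path (induced e (~: F)) a s -> desc a -> desc (last a s).
      elim: s a => [|y s IHs] a //= /andP[/and3P[aF yF eay] ps] da.
      apply: IHs ps _; rewrite !inE in aF yF.
      case: (ltngtP (rank a) (rank y)) => [lt|lt|/rank_inj <- //].
        have [b eb] := early1 y yF.
        apply: (connect_trans da); apply: connect1; rewrite /= aF yF eb.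
        have -> : a = b by apply: earlyE eb _ lt; rewrite sym.
        by rewrite !eqxx.
      have [aw|[b db eb]] := desc_parent a da.
        by move: lt; rewrite aw ltnNge w_min //= in_setC.
      by have -> : y = b by apply: earlyE eb _ lt.
    case/connectP: conn_wx => s ps ->; apply: walk ps _; exact: connect0.
  move/desc_parent=> [//|[a da ea]].
  have lt_px : rank p < rank x.
    by apply: leq_trans lt_pw _; apply: w_min; rewrite /= in_setC.
  have pa : p = a by apply: earlyE ea _ lt_px; rewrite sym.
  by have := desc_white a da; rewrite -pa pF.
apply: IH; last by apply: subset_trans tokF (subsetUr _ _).
move: cF; rewrite (cardsD1 w) inE wF => -[<-]; apply: eq_card => x.
by rewrite !inE negb_or.
Qed.

Lemma card_token_set :
  #|token_set| + #|T| <=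
    #|[set p : T * T | e p.1 p.2 && (rank p.2 < rank p.1)]| + 2.
Proof.
have -> : #|[set p : T * T | e p.1 p.2 && (rank p.2 < rank p.1)]|
          = \sum_x #|earlier x|.
  rewrite -sum1_card (eq_bigl (fun p : T * T => predT p.1 && (p.2 \in earlier p.1))).
    rewrite -(pair_big_dep predT (fun x y => y \in earlier x) (fun _ _ => 1)).
    by apply: eq_bigr => x _; rewrite sum1_card.
  by move=> p; rewrite !inE.
have -> : #|token_set| = \sum_x (x \in token_set).
  by rewrite -sum1_card big_mkcond; apply: eq_bigr => x _; case: (x \in _).
rewrite -(sum1_card T) -big_split /= (bigD1 r) //= [X in _ <= X + _](bigD1 r) //=.
have le : \sum_(x | x != r) ((x \in token_set) + 1) <= \sum_(x | x != r) #|earlier x|.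
  apply: leq_sum => x /has_earlier[y yx]; rewrite inE.
  have : 0 < #|earlier x| by apply/card_gt0P; exists y; rewrite inE.
  by case: #|earlier x| => [|[|k]].
have := leq_b1 (r \in token_set); lia.
Qed.

Lemma Zq0_upper :
  Zq 0 e + #|T| <= #|[set p : T * T | e p.1 p.2 && (rank p.2 < rank p.1)]| + 2.
Proof.
apply: leq_trans card_token_set; rewrite leq_add2r /Zq.
case: ex_minnP => k _; apply; apply/asboolP.
rewrite -[#|_|]addn0; apply: wins_tokens; rewrite setU0.
exact: wins_from_token_set.
Qed.

End UpperBound.

(** * Lower bound: a potential from edge-disjoint cycles *)

Section LowerBound.
Variables (T : finType) (e : rel T).
Hypothesis simple : simple_graph e.

Definition edges : {set {set T}} :=
  [set [set p.1; p.2] | p in [set p : T * T | e p.1 p.2]].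

Lemma edges_oriented (rank : T -> nat) : injective rank ->
  #|edges| = #|[set p : T * T | e p.1 p.2 && (rank p.2 < rank p.1)]|.
Proof.
have [sym irr] := simple.
move=> rank_inj; rewrite -[RHS](@card_in_imset _ _ (fun p : T * T => [set p.1; p.2])).
  apply: eq_card => f; apply/imsetP/imsetP => -[[x y]]; rewrite inE /=.
    move=> exy ->; case: (ltngtP (rank y) (rank x)) => [lt|lt|/rank_inj yx].
    - by exists (x, y); rewrite ?inE //= exy.
    - by exists (y, x); rewrite ?inE //= 1?sym ?exy // setUC.
    by rewrite yx irr in exy.
  by move=> /andP[exy _] ->; exists (x, y); rewrite ?inE.
move=> [x y] [a b]; rewrite !inE /= => /andP[_ lt1] /andP[_ lt2] /setP E.
have := E x; have := E y; have := E a.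
rewrite !inE !eqxx /= ?orbT => /orP[]/eqP ax; rewrite ax in lt2 *.
  move=> /esym/orP[/eqP yx|/eqP-> //].
  by rewrite yx ltnn in lt1.
move=> _ /esym/orP[]/eqP xy; first by rewrite xy ltnn in lt1.
by rewrite -xy ltnNge ltnW in lt2.
Qed.

(** Two vertices of a cycle determine the same edge only if each is next to the
    other, which needs length 2. *)
Lemma card_cycle_edges (c : seq T) : is_cycle e c -> #|cycle_edges c| = size c.
Proof.
case=> /andP[_ uniq_c] size_c; rewrite card_in_imset; first exact/card_uniqP.
move=> x y xc yc /setP E.
have := E x; have := E y; rewrite !inE !eqxx /= => /orP[/eqP-> //|/eqP yx].
move=> /esym/orP[/eqP //|/eqP xy].
case: (rot_to xc) => i s Ec.
have := uniq_c; rewrite -(rot_uniq i) Ec.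
have: 2 < size (x :: s) by rewrite -Ec size_rot.
move: xy; rewrite yx -!(next_rot i uniq_c) Ec.
case: s {Ec} => [|a [|b s]] //=; rewrite !eqxx.
case: (a =P x) => [->|_]; first by rewrite mem_head.
by move=> /= -> _; rewrite !inE eqxx !orbT.
Qed.

Lemma cycle_edges_sub (c : seq T) : is_cycle e c -> cycle_edges c \subset edges.
Proof.
case=> /andP[cyc_c uniq_c] _; apply/subsetP => f /imsetP[x xc ->].
by apply/imsetP; exists (x, next c x); rewrite ?inE //=; exact: next_cycle.
Qed.

(** This captures what the two forcing rules have in common: it holds when W is
    the whole vertex set, and when W is F together with components of the
    complement of F; it also survives forces within W. *)
Definition white_closed (W F : {set T}) :=
  forall x y, x \notin F -> y \notin F -> e x y -> (x \in W) = (y \in W).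

(** If u were the only filled vertex of the cycle, the rest of the cycle would be
    an unfilled path with w on it, hence contained in W; its two ends are distinct
    neighbours of u, and u could not force. *)
Lemma cycle_force_late (c : seq T) (W F : {set T}) u w :
  is_cycle e c -> white_closed W F -> u \in c -> w \in c ->
  u \in F -> w \in W :\: F -> {in W :\: F, forall x, e u x -> x = w} ->
  1 < #|[set x in c] :&: F|.
Proof.
have [sym irr] := simple.
case=> /andP[cyc_c uniq_c] size_c closedF uc wc uF wWF only.
rewrite ltnNge; apply/negP => le1.
have Fc x : x \in c -> x \in F -> x = u.
  by move=> xc xF; apply: (card_le1_eqP le1); rewrite !inE ?xc ?uc.
case: (rot_to uc) => i s Ec.
have sizeE : size c = (size s).+1 by rewrite -(size_rot i) Ec.
move: cyc_c (uniq_c); rewrite -(rot_cycle i) -(rot_uniq i) Ec /=.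
have [wW wF] := setDP wWF.
have white x : x \in s -> u \notin s -> x \notin F.
  move=> xs us; apply: contraNN us => xF.
  have xc : x \in c by rewrite -(mem_rot i) Ec inE xs orbT.
  by rewrite -(Fc x).
have ws : w \in s.
  have : w \in rot i c by rewrite mem_rot.
  by rewrite Ec inE => /orP[/eqP wu|//]; rewrite wu uF in wF.
case: s sizeE white ws {Ec} => [//|a s] sizeE white ws /=.
rewrite rcons_path => /andP[eua /andP[pas elu]] /andP[us /andP[as_ _]].
have sameW b s' : path e b s' -> (forall x, x \in b :: s' -> x \notin F) ->
    forall x, x \in b :: s' -> (x \in W) = (b \in W).
  elim: s' b => [|d s' IH] b /= => [_ _ x|/andP[ebd ps'] wh x].
    by rewrite inE => /eqP->.
  rewrite inE => /orP[/eqP-> //|xs'].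
  rewrite (IH d) // => [|y ys']; last by apply: wh; rewrite inE ys' orbT.
  by apply/esym/closedF => //; apply: wh; rewrite !inE eqxx ?orbT.
have white' x : x \in a :: s -> x \notin F by move/white; apply.
have inW x : x \in a :: s -> x \in W.
  by move=> xs; rewrite (sameW a s) // -(sameW a s pas white' w).
have aw : a = w by apply: only => //; rewrite inE white' ?inW ?mem_head.
have lw : last a s = w.
  by apply: only; rewrite 1?sym // inE white' ?inW ?mem_last.
case: s sizeE as_ lw {ws white us pas elu sameW white' inW} => [|b s] sizeE.
  by rewrite sizeE in size_c.
by move=> as_ lw; rewrite aw -lw /= mem_last in as_.
Qed.

Variables (I : finType) (c : I -> seq T).
Hypothesis cyc : forall i, is_cycle e (c i).
Hypothesis edge_disjoint : forall i j f,
  f \in cycle_edges (c i) -> f \in cycle_edges (c j) -> i = j.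

Definition free_edges := edges :\: \bigcup_i cycle_edges (c i).

(** An upper bound for the number of forces that can have led to F: each free edge
    carries at most one, and the first two filled vertices of a cycle are not
    forced along the cycle.  The truncated subtraction is meant: a cycle with
    fewer than two filled vertices counts for 0. *)
Definition potential (F : {set T}) :=
  #|[set f in free_edges | f \subset F]|
  + \sum_i (#|[set x in c i] :&: F| - 2).

Lemma potential_mono (F F' : {set T}) :
  F \subset F' -> potential F <= potential F'.
Proof.
move=> sFF'; apply: leq_add.
  apply: subset_leq_card; apply/subsetP => f; rewrite !inE => /andP[-> fF].
  exact: subset_trans fF sFF'.
by apply: leq_sum => i _; apply: leq_sub2r; apply/subset_leq_card/setIS.
Qed.

Lemma potential0 : potential set0 = 0.
Proof.
rewrite /potential big1 ?addn0 => [|i _]; last by rewrite setI0 cards0.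
apply: eq_card0 => f; rewrite !inE subset0; apply/andP => -[/andP[_]].
by case/imsetP=> p _ -> /eqP/setP/(_ p.1); rewrite !inE eqxx.
Qed.

(** A cycle of length k contributes k - 2, while its k edges are not free and
    belong to no other cycle. *)
Lemma potentialT : potential [set: T] + 2 * #|I| <= #|edges|.
Proof.
rewrite /potential -addnA.
have cover_edges : \bigcup_i cycle_edges (c i) \subset edges.
  by apply/bigcupsP => i _; apply: cycle_edges_sub; apply: cyc.
have card_cover :
    #|\bigcup_i cycle_edges (c i)| = \sum_i size (c i).
  under [RHS]eq_bigr => i _ do rewrite -(card_cycle_edges (cyc i)) -sum1_card.
  rewrite -sum1_card; apply: partition_disjoint_bigcup => i j ij.
  rewrite disjoint_subset; apply/subsetP => f fi; rewrite inE.
  by apply: contra_neqN ij => fj; apply: edge_disjoint fi fj.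
rewrite -(cardsID (\bigcup_i cycle_edges (c i)) edges) addnC.
apply: leq_add; last first.
  by apply: subset_leq_card; apply/subsetP => f; rewrite inE => /andP[].
rewrite (setIidPr cover_edges) card_cover mulnC -sum_nat_const -big_split /=.
apply: leq_sum => i _; have [/andP[_ uniq_ci] size_ci] := cyc i.
by rewrite setIT cardsE (card_uniqP uniq_ci) subnK // ltnW.
Qed.

(** The edge of the force is either free, and then becomes an edge inside the
    filled set, or on one of the cycles, which already has two filled vertices
    and gains one. *)
Lemma potential_force (W F F' : {set T}) :
  white_closed W F -> force_step e W F F' ->
  [/\ F \subset F', #|F'| = #|F|.+1 & potential F < potential F'].
Proof.
have [sym irr] := simple.
move=> closedF /exists_inP[u uFW /exists_inP[w wWF]].
move=> /and3P[euw /forall_inP only /eqP->].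
have [uF _] := setIP uFW; have [wW wF] := setDP wWF.
have sFF' : F \subset w |: F by apply: subsetUr.
split; rewrite ?cardsU1 ?wF //.
have edge_uw : [set u; w] \in edges by apply/imsetP; exists (u, w); rewrite ?inE.
have mono_free : [set f in free_edges | f \subset F]
               \subset [set f in free_edges | f \subset w |: F].
  by apply/subsetP => f; rewrite !inE => /andP[-> /subset_trans->].
have mono_cycle i : #|[set x in c i] :&: F| - 2 <= #|[set x in c i] :&: (w |: F)| - 2.
  by apply: leq_sub2r; apply/subset_leq_card/setIS.
have [free|] := boolP ([set u; w] \in free_edges).
  rewrite /potential -addSn; apply: leq_add; last exact: leq_sum.
  apply: proper_card; rewrite properE mono_free /=; apply/subsetPn.
  exists [set u; w]; first by rewrite inE free subUset !sub1set !inE eqxx uF orbT.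
  by rewrite inE free subUset !sub1set (negPf wF) andbF.
rewrite inE edge_uw andbT negbK => /bigcupP[i _ uw_ci].
rewrite /potential -addnS; apply: leq_add; first exact: subset_leq_card.
rewrite (bigD1 i) //= [X in _ <= X](bigD1 i) //= -addSn; apply: leq_add; last exact: leq_sum.
have /andP[uc wc] : (u \in c i) && (w \in c i).
  have : [set u; w] \subset [set x in c i].
    by case/imsetP: uw_ci => x xc ->; rewrite subUset !sub1set !inE mem_next xc.
  by rewrite subUset !sub1set !inE.
have late : 1 < #|[set x in c i] :&: F|.
  apply: (cycle_force_late (cyc i) closedF uc wc uF wWF) => x xWF eux.
  by apply/eqP; apply: (implyP (only x xWF)).
have -> : [set x in c i] :&: (w |: F) = w |: ([set x in c i] :&: F).
  by apply/setP => x; rewrite !inE; case: (x =P w) => //= ->; rewrite wc.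
by rewrite cardsU1 !inE (negPf wF) andbF add1n subSn.
Qed.

Lemma potential_forces (W F F' : {set T}) :
  white_closed W F -> connect (force_step e W) F F' ->
  potential F + #|F'| <= potential F' + #|F|.
Proof.
move=> closedF /connectP[s]; elim: s F closedF => [|F1 s IH] F closedF /=.
  by move=> _ ->.
case/andP=> /(potential_force closedF)[sFF1 cF1 ltF1] ps lastF'.
have closedF1 : white_closed W F1.
  by move=> x y xF yF; apply: closedF; [apply: contraNN xF | apply: contraNN yF];
    apply: (subsetP sFF1).
have := leq_add (IH F1 closedF1 ps lastF') ltF1.
rewrite cF1; lia.
Qed.

Lemma component_white_closed (F U : {set T}) :
  U \in components e (~: F) -> white_closed (F :|: U) F.
Proof.
have [sym _] := simple.
case/imsetP=> z zF -> x y xF yF exy.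
rewrite !inE (negPf xF) (negPf yF) /=.
have step_xy : induced e (~: F) x y by rewrite /induced /= !in_setC xF yF.
have step_yx : induced e (~: F) y x by rewrite /induced /= !in_setC xF yF sym.
apply/idP/idP => zc; first exact: connect_trans zc (connect1 step_xy).
exact: connect_trans zc (connect1 step_yx).
Qed.

(** A token raises the size of F by at most one and a force raises it by one; the
    forces still to come are at most the potential still to be gained.  Against
    a selection of several components, it suffices to consider the oracle that
    answers a single one. *)
Lemma player_wins_potential k (F : {set T}) :
  player_wins 0 e k F -> #|T| + potential F <= k + #|F| + potential [set: T].
Proof.
elim=> {k F} [k|k F v _ IH|k F F' step _ IH|k F S reply subS S_gt0 conn _ IH].
- by rewrite cardsT leq_add2r leq_addl.
- apply: leq_trans (leq_add (leqnn _) (potential_mono (subsetUr [set v] F))) _.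
  apply: leq_trans IH _; rewrite leq_add2r addSnnS leq_add2l cardsU1.
  by case: (v \in F).
- have closedT : white_closed [set: T] F by move=> x y _ _ _; rewrite !inE.
  have := leq_add IH (potential_forces closedT (connect1 step)).
  lia.
- have /card_gt0P[U US] := S_gt0.
  have sUS : [set U] \subset S by rewrite sub1set.
  have U0 : [set U] != set0 by apply/set0Pn; exists U; rewrite inE.
  have /component_white_closed closedF : U \in components e (~: F) by apply: (subsetP subS).
  have := conn _ sUS U0; rewrite /cover big_set1 => /(potential_forces closedF) forces.
  have := leq_add (IH _ sUS U0) forces.
  lia.
Qed.

Lemma Zq0_lower : #|T| + 2 * #|I| <= Zq 0 e + #|edges|.
Proof.
rewrite /Zq; case: ex_minnP => k /asboolP /player_wins_potential + _.
rewrite potential0 cards0 !addn0 => win.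
apply: leq_trans (leq_add win (leqnn _)) _.
by rewrite -addnA leq_add2l potentialT.
Qed.

End LowerBound.

(** * Fundamental cycles and the value of the game *)

Section FundamentalCycles.
Variables (T : finType) (e : rel T).
Hypothesis simple : simple_graph e.
Variables (r : T) (par : T -> T) (rank : T -> nat).
Hypothesis parP : forall x, x != r -> e x (par x) && (rank (par x) < rank x).

Definition tree_edges : {set {set T}} := [set [set x; par x] | x in [set~ r]].

Definition chords := edges e :\: tree_edges.

Lemma card_chords : #|edges e| < #|chords| + #|T|.
Proof.
have T_gt0 : 0 < #|T| by apply/card_gt0P; exists r.
have le : #|tree_edges| <= #|T|.-1.
  by apply: leq_trans (leq_imset_card _ _) _; rewrite cardsC1.
have := cardsID tree_edges (edges e).
have := subset_leq_card (subsetIr (edges e) tree_edges).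
rewrite -/chords; lia.
Qed.

(** A duplicate-free path in the tree from one end of the chord f to the other
    closes up, by f, to a cycle whose other edges are all in the tree.  The path
    has at least two edges, since f itself is not in the tree. *)
Lemma fundamental_cycle f : f \in chords ->
  exists c, [/\ is_cycle e c, f \in cycle_edges c &
    forall g, g \in cycle_edges c -> g \in chords -> g = f].
Proof.
have [sym irr] := simple.
case/setDP=> /imsetP[[x y]]; rewrite inE /= => exy -> not_tree.
pose tree : rel T := [rel a b | [set a; b] \in tree_edges].
have tree_sym : symmetric tree by move=> a b; rewrite /tree /= setUC.
have tree_e a b : tree a b -> e a b.
  case/imsetP=> z; rewrite !inE => /parP/andP[ezp _] /setP E.
  have := E z; have := E (par z); have := E a; have := E b.
  rewrite !inE !eqxx !orbT /=.
  move=> /esym/orP[]/eqP-> /esym/orP[]/eqP-> //.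
  - by move=> /orP[]/eqP pz; rewrite pz irr in ezp.
  - by rewrite sym.
  - by move=> _ /orP[]/eqP z_eq; rewrite -z_eq irr in ezp.
have to_root z : connect tree z r.
  have [n] := ubnP (rank z); elim: n z => [//|n IH] z lt_zn.
  have [->|zr] := eqVneq z r; first exact: connect0.
  have /andP[_ lt_pz] := parP zr.
  apply: connect_trans (connect1 _) (IH (par z) _).
    by apply/imsetP; exists z; rewrite ?inE.
  by rewrite -ltnS; apply: leq_trans lt_zn.
have /connectP[p0 path_p0 last_p0] : connect tree y x.
  by apply: connect_trans (to_root y) _; rewrite (sym_connect_sym tree_sym).
move: last_p0; case/shortenP: path_p0 => p path_p uniq_p _ last_p.
have cyc : is_cycle e (y :: p).
  split; last first.
    case: p last_p path_p {uniq_p} => [|a [|b p]] //= yx.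
      by rewrite -yx irr in exy.
    by rewrite -yx andbT /tree /= setUC => tree_xy; rewrite tree_xy in not_tree.
  rewrite /ucycle uniq_p andbT /= rcons_path -last_p exy andbT.
  exact: sub_path path_p.
exists (y :: p); split=> //.
  apply/imsetP; exists x; first by rewrite last_p mem_last.
  by rewrite last_p next_nth mem_last index_last // nth_default.
have tree_or_f z : z \in y :: p -> [set z; next (y :: p) z] \in tree_edges
    \/ [set z; next (y :: p) z] = [set x; y].
  have : cycle [rel a b | tree a b || (a == x) && (b == y)] (y :: p).
    rewrite /= rcons_path /= -last_p !eqxx orbT andbT.
    by apply: sub_path path_p => a b /= ->.
  by move=> /next_cycle/[apply]/orP[|/andP[/eqP-> /eqP->]]; [left|right].
move=> g /imsetP[z /tree_or_f[tree_g|->] ->] //.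
by rewrite inE tree_g.
Qed.

End FundamentalCycles.

(** If two fundamental cycles shared an edge they would have the same edges, and
    each contains a single chord.  The number of edges is
    expressed by an arbitrary numbering of the vertices, so as to match the
    entries below the diagonal. *)
Lemma Zq0_cactus (T : finType) (e : rel T) (rank : T -> nat) :
  simple_graph e -> connected_graph e -> cactus e -> injective rank ->
  Zq 0 e = #|[set p : T * T | e p.1 p.2 && (rank p.2 < rank p.1)]| + 2 - #|T|.
Proof.
move=> simple conn cac inj_rank; have [sym irr] := simple.
have [r [rk [inj_rk earlier_rk]]] := earlier_neighbour_rank sym conn.
have upper := Zq0_upper sym inj_rk earlier_rk.
rewrite -(edges_oriented simple inj_rk) in upper.
rewrite -(edges_oriented simple inj_rank).
have /boolp.choice[par parP] x : exists y, x != r -> e x y && (rk y < rk x).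
  by have [->|/earlier_rk[y]] := eqVneq x r; [exists r | exists y].
pose I := {f : {set T} | f \in chords e r par}.
have /boolp.choice[c cP] (i : I) : exists c, [/\ is_cycle e c,
    val i \in cycle_edges c &
    forall g, g \in cycle_edges c -> g \in chords e r par -> g = val i].
  by apply: (fundamental_cycle simple parP (valP i)).
have cyc i : is_cycle e (c i) by have [] := cP i.
have edge_disjoint i j f :
    f \in cycle_edges (c i) -> f \in cycle_edges (c j) -> i = j.
  move=> fi fj; have [_ _ only] := cP i; have [_ ej _] := cP j.
  apply/val_inj/esym/only; last exact: valP.
  by rewrite (cac _ _ (cyc i) (cyc j) f fi fj).
have := Zq0_lower simple cyc edge_disjoint.
have := card_chords e r par.
have -> : #|{: I}| = #|chords e r par| by rewrite card_sig; apply: eq_card.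
lia.
Qed.

(** * The counting program *)

(** Register 1 holds 1, register 2 the row i, register 3 the column j, register 4
    the offset i * n, and register 6 the number of edges found so far.  The
    instructions from 10 on read one entry and return to the test j < i at 1;
    those from 2 to 5 move to the next row; those from 6 on output the number of
    edges plus 2 minus n.  The addition comes before the truncated
    subtraction, as m - n is -1 for a tree. *)
Definition cactus_program : program :=
  [:: Const 1 1
   ;  JumpLt 3 2 10
   ;  Add 2 2 1
   ;  Const 3 0
   ;  Add 4 4 0
   ;  JumpLt 2 0 1
   ;  Const 7 2
   ;  Add 6 6 7
   ;  Defs.Sub 0 6 0
   ;  Halt
   ;  Add 5 4 3
   ;  Read 7 5
   ;  Add 6 6 7
   ;  Add 3 3 1
   ;  Jump 1 ].

Lemma run_step p w t s s' :
  step w s (nth Halt p (pc s)) = Some s' -> run p w t.+1 s = run p w t s'.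
Proof.
have -> : run p w t.+1 s =
    if nth Halt p (pc s) is Halt then Some (regs s 0)
    else obind (run p w t) (step w s (nth Halt p (pc s))).
  by rewrite [LHS]/=; case: (nth Halt p (pc s)).
by case: (nth Halt p (pc s)) => [r k|r a b|r a b|r a|a b|l|a b l|] // ->.
Qed.

Section Execution.
Variables (n w : nat) (M : nat -> nat).
Hypothesis w_big : n * n + 2 < w.
Hypothesis M_bit : forall a, M a <= 1.

(** The machine is about to compare j and i, having found a edges. *)
Record scanning (i j a : nat) (s : state) : Prop := Scanning {
  scan_pc : pc s = 1;
  scan_n : regs s 0 = n;
  scan_one : regs s 1 = 1;
  scan_row : regs s 2 = i;
  scan_col : regs s 3 = j;
  scan_base : regs s 4 = i * n;
  scan_acc : regs s 6 = a;
  scan_mem : Defs.mem s = M }.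

Lemma run_entry t i j a s : scanning i j a s -> j < i -> i < n -> a < n * n ->
  exists2 s', scanning i j.+1 (a + M (i * n + j)) s' &
    run cactus_program w (6 + t) s = run cactus_program w t s'.
Proof.
case: s => pc0 R mm [pcE R0 R1 R2 R3 R4 R6 memE] lt_ji lt_in lt_a.
rewrite /= in pcE R0 R1 R2 R3 R4 R6 memE; subst pc0 mm.
have lt_addr : i * n + j < w by nia.
have lt_bit : M (i * n + j) < w by have := M_bit (i * n + j); lia.
have lt_acc : a + M (i * n + j) < w by have := M_bit (i * n + j); lia.
have lt_col : j + 1 < w by nia.
(* A step is a computation once the registers and the word bounds are known. *)
do 6!(rewrite addSn; erewrite run_step; last by
  rewrite /= ?R2 ?R3 ?lt_ji /set_reg /= ?R4 ?R3 ?lt_addr /= ?lt_bit /= ?R6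
    ?lt_acc /= ?R3 ?R1 ?lt_col /=; reflexivity).
eexists; last reflexivity.
by split; rewrite //= addn1.
Qed.

Lemma run_next_row t i a s : scanning i i a s -> i.+1 < n ->
  exists2 s', scanning i.+1 0 a s' &
    run cactus_program w (5 + t) s = run cactus_program w t s'.
Proof.
case: s => pc0 R mm [pcE R0 R1 R2 R3 R4 R6 memE] lt_in.
rewrite /= in pcE R0 R1 R2 R3 R4 R6 memE; subst pc0 mm.
have lt_row : i + 1 < w by nia.
have lt_base : i * n + n < w by nia.
have w_gt0 : 0 < w by lia.
have more : i + 1 < n by rewrite addn1.
do 5!(rewrite addSn; erewrite run_step; last by
  rewrite /= ?R2 ?R3 ?R0 ?ltnn /set_reg /= ?R2 ?R1 ?lt_row /= ?w_gt0 ?R4 ?R0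
    ?lt_base /= ?R2 ?R1 ?R0 ?more /=; reflexivity).
eexists; last reflexivity.
by split; rewrite //= ?addn1 // mulSn addnC.
Qed.

(** The steps are the two failing tests j < i and i < n, the three that pass to
    row n, and the three that compute the output; Halt costs none. *)
Lemma run_finish t a s : scanning n.-1 n.-1 a s -> 0 < n -> a <= n * n ->
  run cactus_program w (8 + t) s = Some (a + 2 - n).
Proof.
case: s => pc0 R mm [pcE R0 R1 R2 R3 R4 R6 memE] n_gt0 le_a.
rewrite /= in pcE R0 R1 R2 R3 R4 R6 memE; subst pc0 mm.
have rowE : n.-1 + 1 = n by rewrite addn1 prednK.
have lt_row : n < w by nia.
have lt_base : n.-1 * n + n < w by nia.
have w_gt0 : 0 < w by lia.
have w_gt2 : 2 < w by lia.
have lt_acc : a + 2 < w by lia.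
have lt_res : a + 2 - n < w by lia.
do 8!(rewrite addSn; erewrite run_step; last by
  rewrite /= ?R2 ?R3 ?R0 ?ltnn /set_reg /= ?R2 ?R1 ?rowE ?lt_row /= ?w_gt0 ?R4
    ?R0 ?lt_base /= ?R2 ?R1 ?R0 ?rowE ?ltnn /= ?w_gt2 /= ?R6 ?lt_acc /= ?R0 ?lt_res /=;
  reflexivity).
by rewrite /= ?R6; case: t.
Qed.

Lemma run_row t i j a s : scanning i j a s -> j <= i -> i < n ->
  a + (i - j) <= n * n ->
  exists2 s', scanning i i (a + \sum_(j <= k < i) M (i * n + k)) s' &
    run cactus_program w (6 * (i - j) + t) s = run cactus_program w t s'.
Proof.
have [m] := ubnP (i - j); elim: m j a s => // m IH j a s lt_m scan le_ji lt_in le_a.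
have [lt_ji|] := ltnP j i; last first.
  move=> le_ij; have eq_ij : j = i by apply/eqP; rewrite eqn_leq le_ji.
  by subst j; exists s; rewrite ?big_geq ?addn0 // subnn.
have [|s1 scan1 run1] := run_entry (6 * (i - j.+1) + t) scan lt_ji lt_in; first lia.
have bit := M_bit (i * n + j).
have [||||s' scan' run'] := IH j.+1 _ s1 _ scan1; try lia.
exists s'; first by rewrite big_ltn // addnA.
by rewrite -run' -run1; congr run; lia.
Qed.

(** A row takes at most 6 * n + 5 steps: 6 for each entry, and 5 for the failing
    test and the passage to the next row.  The last row ends with 8 steps in
    place of the 5, whence the 3. *)
Lemma run_rows t i a s : scanning i 0 a s -> i < n -> a <= i * n ->
  (6 * n + 5) * (n - i) + 3 <= t ->
  run cactus_program w t s =
    Some (a + \sum_(i <= k < n) \sum_(0 <= j < k) M (k * n + j) + 2 - n).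
Proof.
have [m] := ubnP (n - i); elim: m t i a s => // m IH t i a s lt_m scan lt_in le_a le_t.
have row_le : \sum_(0 <= k < i) M (i * n + k) <= i.
  by rewrite -[X in _ <= X]muln1 -[X in _ <= X * _]subn0 -sum_nat_const_nat leq_sum.
have left : n - i = (n - i.+1).+1 by lia.
rewrite left mulnS in le_t; set rest := _ * (n - i.+1) in le_t.
have [t' tE] : exists t', t = 6 * (i - 0) + (5 + t').
  by exists (t - (6 * i + 5)); lia.
rewrite tE in le_t *.
have [||s1 scan1 ->] := run_row (5 + t') scan _ lt_in; [lia|nia|].
have [lt_i1n|le_ni] := ltnP i.+1 n.
  have [s2 scan2 ->] := run_next_row t' scan1 lt_i1n.
  rewrite (IH t' i.+1 _ s2 _ scan2) //.
  - by rewrite [in RHS]big_ltn // addnA.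
  - lia.
  - by rewrite mulSn; lia.
  - by rewrite -/rest; lia.
have [t'' ->] : exists t'', 5 + t' = 8 + t'' by exists (t' - 3); lia.
have iE : n = i.+1 by lia.
have scan_last : scanning n.-1 n.-1 (a + \sum_(0 <= k < i) M (i * n + k)) s1.
  by rewrite [in n.-1]iE.
rewrite (run_finish t'' scan_last); [|lia|nia].
by rewrite [in RHS]iE big_nat1 -iE.
Qed.

End Execution.

Lemma graph_input_entry n (e : rel 'I_n) (i j : 'I_n) :
  Defs.mem (graph_input e) (i * n + j) = e i j.
Proof.
rewrite /=; congr nat_of_bool; apply/existsP/idP => [[i' /existsP[j' /andP[/eqP E]]]|eij].
  have n_gt0 : 0 < n by apply: leq_ltn_trans (ltn_ord i).
  have -> : i' = i.
    apply/val_inj; have := congr1 (divn^~ n) E.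
    by rewrite /= !divnMDl // !divn_small // !addn0.
  have -> // : j' = j.
  apply/val_inj; have := congr1 (modn^~ n) E.
  by rewrite /= !modnMDl !modn_small.
by exists i; apply/existsP; exists j; rewrite eqxx.
Qed.

Lemma card_below_diagonal n (e : rel 'I_n) :
  \sum_(0 <= i < n) \sum_(0 <= j < i) Defs.mem (graph_input e) (i * n + j) =
  #|[set p : 'I_n * 'I_n | e p.1 p.2 && (p.2 < p.1)]|.
Proof.
pose M := Defs.mem (graph_input e).
have -> : #|[set p : 'I_n * 'I_n | e p.1 p.2 && (p.2 < p.1)]|
          = \sum_(i < n) \sum_(j < n | j < i) e i j.
  rewrite -sum1_card pair_big_dep /= big_mkcond [in RHS]big_mkcond.
  by apply: eq_bigr => -[i j] _; rewrite inE /=; case: (e i j); case: (j < i).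
rewrite big_mkord; apply: eq_bigr => i _.
rewrite big_mkord (big_ord_widen n (fun j => M (i * n + j))) 1?ltnW //.
by apply: eq_bigr => j _; rewrite -graph_input_entry.
Qed.

(* MathComp world.  The time bound is c * n ^ 2 steps, on words of O(log n)
   bits: all stored values are below (n + 2) ^ d. *)
Theorem mainTheorem2 :
  exists (p : program) (c d : nat),
    forall (n : nat) (e : rel 'I_n),
      simple_graph e -> connected_graph e -> cactus e ->
      run p (n.+2 ^ d) (c * n ^ 2) (graph_input e) = Some (Zq 0 e).
Proof.
(* One initial step, then (6 * n + 5) * n + 3 steps, at most 15 * n ^ 2 as n > 0. *)
exists cactus_program, 15, 2 => n e simple conn cac.
have n_gt0 : 0 < n by have [] := conn; rewrite card_ord.
rewrite (Zq0_cactus simple conn cac (@ord_inj n)) card_ord -card_below_diagonal.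
have w_big : n * n + 2 < n.+2 ^ 2 by lia.
have M_bit a : Defs.mem (graph_input e) a <= 1 by apply: leq_b1.
have [t tE] : exists t, 15 * n ^ 2 = t.+1 by exists (15 * n ^ 2).-1; nia.
move: (n.+2 ^ 2) w_big => w w_big.
have w_gt1 : 1 < w by lia.
rewrite tE; erewrite run_step; last by rewrite /= /set_reg w_gt1; reflexivity.
rewrite (@run_rows n _ _ w_big M_bit t 0 0) ?subn0 ?add0n //.
by nia.
Qed.
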